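(* Let $X$ have finite support, let $x=(x_1,\dots,x_T)$ be a path with $P^{\mathrm{obs}}(X=x)>0$ and suppose $P^{\mathrm{obs}}(Y=y^j\mid X=x)=p_j>0$, $j=1,\dots,J$, with $y^1,\dots,y^J\in\mathbb R^T$ distinct and $\sum_jp_j=1$. Fix $b\in\mathcal B$. Let $\delta_x(b)$ be the value of the linear program $$\delta_x(b)=\min_{\lambda^-,\lambda^+,d}\ \sum_{j=1}^Jp_jd_j$$ over $d\in\mathbb R^J$ and $\lambda^\pm=(\lambda^\pm_{pt})_{p\le P,t\le T}$ subject to $d_j\ge s_{jp}(b;\lambda)$ for all $j\le J,p\le P$; $\lambda_{pt}^-,\lambda_{pt}^+\ge0$ for all $p,t$; and $\sum_{p=1}^P\sum_{t=1}^T(\lambda_{pt}^-+\lambda_{pt}^+)\le1$. Then $\delta_x(b)\le0$, and $$\delta_x(b)=0\iff\text{the pathwise primal coupling LP is feasible},\qquad \delta_x(b)<0\iff\text{the pathwise primal coupling LP is infeasible}.$$ A negative optimum supplies an observable inequality excluding $b$: if $\delta_x(b)<0$, an optimal $\lambda$ satisfies $\sum_{j}p_j\max_{p\le P}s_{jp}(b;\lambda)<0$, and this implies $b\notin\Theta_I$.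
   Context: $T,k\ge1$ are fixed integers, $\tau\in(0,1)$, $\mathcal B\subseteq\mathbb R^k$; $P^{\mathrm{obs}}$ is the law of $(Y,X)$, $Y\in\mathbb R^T$, $X=(X_1,\dots,X_T)$, $X_t\in\mathbb R^k$. Notation for the path $x$: $z_{jt}(b)=y^j_t-x_t'b$; $v_1<\dots<v_P$ are the distinct values among the $JT$ numbers $z_{jt}(b)$; $$s_{jp}(b;\lambda)=\sum_{t=1}^T\Big[\lambda_{pt}^-\{\mathbf 1(z_{jt}(b)\le v_p)-\tau\}+\lambda_{pt}^+\{\tau-\mathbf 1(z_{jt}(b)<v_p)\}\Big].$$ Pathwise primal coupling LP: find $(q_{jp})$ with $q_{jp}\ge0$; $\sum_{p}q_{jp}=p_j$ for all $j$; and for all $p\le P$, $t\le T$, $\sum_{j:z_{jt}(b)\le v_p}q_{jp}\ge\tau\sum_jq_{jp}$ and $\sum_{j:z_{jt}(b)<v_p}q_{jp}\le\tau\sum_jq_{jp}$. Identified set: $\Theta_I$ is the set of $b\in\mathcal B$ for which there exists a Borel probability law $P^{\mathrm s}$ of $(Y,X,A,U)$, $A\in\mathbb R$, $U\in\mathbb R^T$, with $(Y,X)$-marginal $P^{\mathrm{obs}}$, with $Y_t=X_t'b+A+U_t$ a.s. for all $t$, and with $P^{\mathrm s}(U_t\le0\mid X,A)\ge\tau$, $P^{\mathrm s}(U_t<0\mid X,A)\le\tau$ a.s. for all $t$. *)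

(* Defs.v *)
From mathcomp Require Import all_boot all_order all_algebra.
From mathcomp Require Import all_classical all_reals all_analysis.

Set Implicit Arguments.
Unset Strict Implicit.
Unset Printing Implicit Defensive.

Import Order.TTheory GRing.Theory Num.Theory.
Import numFieldNormedType.Exports.

Local Open Scope classical_set_scope.
Local Open Scope ring_scope.

(* [vec R n] is R^n; the library equips it with the product sigma-algebra of
   the Borel sets of R, that is, with the Borel sets of R^n. *)
Notation vec R n := (n.-tuple (measurableTypeR R)).

(* The space of (y, x), with y in R^T and x = (x_1, ..., x_T) in (R^k)^T. *)
Notation obs R T k := (vec R T * T.-tuple (vec R k))%type.

(* The space of ((y, x), (a, u)), with a in R and u in R^T. *)
Notation latent R T k :=
  (obs R T k * (measurableTypeR R * vec R T))%type.

Section Model.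
Context {R : realType} {T k : nat}.

Definition dotp (x b : vec R k) : R :=
  \sum_(i < k) (tnth x i : R) * (tnth b i : R).

Definition Yof (w : latent R T k) : vec R T := w.1.1.
Definition Xof (w : latent R T k) : T.-tuple (vec R k) := w.1.2.
Definition Aof (w : latent R T k) : measurableTypeR R := w.2.1.
Definition Uof (w : latent R T k) : vec R T := w.2.2.
Definition XAof (w : latent R T k) :
  (T.-tuple (vec R k) * measurableTypeR R)%type := (Xof w, Aof w).

End Model.

Section ConditionalProbability.
Context {R : realType} {d d' : measure_display} {W : measurableType d}
  {S : measurableType d'}.

(* Conditional probability given an event of positive probability. *)
Definition pr_given (P : probability W R) (E F : set W) : R :=
  fine (P (E `&` F)) / fine (P F).

(* f is a version of the conditional probability P(E | V): it is measurable
   for the sigma-algebra sigma(V) generated by V, and it integrates to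
   P(E `&` G) on every G in sigma(V). *)
Definition cond_prob_version (P : probability W R) (V : W -> S) (E : set W)
    (f : W -> R) : Prop :=
  [/\ measurable_fun [set: g_sigma_algebra_preimageType V]
        (f : g_sigma_algebra_preimageType V -> measurableTypeR R),
      P.-integrable [set: W] (EFin \o f) &
      forall G : set W, g_sigma_algebra_preimage V G ->
        (\int[P]_(w in G) (f w)%:E = P (E `&` G))%E].

(* Versions exist and are almost surely equal, so asking for one version with
   the stated bound is the same as asking for the bound on all of them. *)
Definition cond_prob_ge (P : probability W R) (V : W -> S) (E : set W)
    (c : R) : Prop :=
  exists2 f : W -> R, cond_prob_version P V E f &
    {ae P, forall w, c <= f w}.

Definition cond_prob_le (P : probability W R) (V : W -> S) (E : set W)
    (c : R) : Prop :=
  exists2 f : W -> R, cond_prob_version P V E f &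
    {ae P, forall w, f w <= c}.

End ConditionalProbability.

Section IdentifiedSet.
Context {R : realType} {T k : nat}.

(* X takes its values in a finite set of paths with probability one. *)
Definition X_finite_support (Pobs : probability (obs R T k) R) : Prop :=
  exists2 S : set (T.-tuple (vec R k)), finite_set S &
    Pobs [set w | S w.2] = 1%E.

Definition identified_set (tau : R) (B : set (vec R k))
    (Pobs : probability (obs R T k) R) : set (vec R k) :=
  [set b | B b /\
    exists Ps : probability (latent R T k) R,
    [/\ forall E : set (obs R T k), measurable E ->
          Ps [set w | E (Yof w, Xof w)] = Pobs E,
        forall t : 'I_T, {ae Ps, forall w,
          (tnth (Yof w) t : R) =
            dotp (tnth (Xof w) t) b + (Aof w : R) + (tnth (Uof w) t : R)},
        forall t : 'I_T,
          cond_prob_ge Ps XAof [set w | (tnth (Uof w) t : R) <= 0] tau &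
        forall t : 'I_T,
          cond_prob_le Ps XAof [set w | (tnth (Uof w) t : R) < 0] tau]].

End IdentifiedSet.

(* The maximum of a nonempty sequence; the head, used as initial value, does
   not change it. *)
Definition seqmax {R : realType} (s : seq R) : R :=
  \big[Num.max/head 0 s]_(r <- s) r.

Section Path.
Context {R : realType} {T k J : nat}.
Variables (tau : R) (x : T.-tuple (vec R k)) (y : 'I_J -> vec R T)
  (pr : 'I_J -> R) (b : vec R k).

Definition zval (j : 'I_J) (t : 'I_T) : R :=
  (tnth (y j) t : R) - dotp (tnth x t) b.

(* The increasing list v_1 < ... < v_P of the distinct values z_jt(b). *)
Definition values : seq R :=
  sort <=%O (undup [seq zval j t | j <- enum 'I_J, t <- enum 'I_T]).

Definition nval : nat := size values.

Definition vval (p : 'I_nval) : R := nth 0 values p.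

(* [lm] is lambda^- and [lp] is lambda^+. *)
Definition score (lm lp : 'I_nval -> 'I_T -> R) (j : 'I_J) (p : 'I_nval) : R :=
  \sum_(t < T) (lm p t * ((zval j t <= vval p)%R%:R - tau)
              + lp p t * (tau - (zval j t < vval p)%R%:R)).

Definition admissible (lm lp : 'I_nval -> 'I_T -> R) : Prop :=
  (forall p t, 0 <= lm p t /\ 0 <= lp p t) /\
  \sum_(p < nval) \sum_(t < T) (lm p t + lp p t) <= 1.

Definition dual_feasible (lm lp : 'I_nval -> 'I_T -> R) (d : 'I_J -> R) : Prop :=
  (forall j p, score lm lp j p <= d j) /\ admissible lm lp.

Definition dual_obj (d : 'I_J -> R) : R := \sum_(j < J) pr j * d j.

Definition dual_optimal (lm lp : 'I_nval -> 'I_T -> R) (d : 'I_J -> R) : Prop :=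
  dual_feasible lm lp d /\
  forall lm' lp' d', dual_feasible lm' lp' d' -> dual_obj d <= dual_obj d'.

Definition delta : R :=
  inf [set r | exists lm lp d, dual_feasible lm lp d /\ r = dual_obj d].

Definition primal_feasible : Prop :=
  exists q : 'I_J -> 'I_nval -> R,
  [/\ forall j p, 0 <= q j p,
      forall j, \sum_(p < nval) q j p = pr j,
      forall p t, tau * \sum_(j < J) q j p
                    <= \sum_(j < J | zval j t <= vval p) q j p &
      forall p t, \sum_(j < J | zval j t < vval p) q j p
                    <= tau * \sum_(j < J) q j p].

Definition max_score_sum (lm lp : 'I_nval -> 'I_T -> R) : R :=
  \sum_(j < J) pr j * seqmax [seq score lm lp j p | p <- enum 'I_nval].

End Path.

Arguments admissible {R T k J} x y b lm lp.
Arguments dual_feasible {R T k J} tau x y b lm lp d.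
Arguments dual_optimal {R T k J} tau x y pr b lm lp d.
Arguments max_score_sum {R T k J} tau x y pr b lm lp.

(* Main.v *)
Require Import Defs.
From mathcomp Require Import all_boot all_order all_algebra.
From mathcomp Require Import all_classical all_reals all_analysis.
From mathcomp Require Import ring lra.

(* The optimal value of the dual is the minimum over the compact set of
   admissible multipliers of the continuous function sum_j p_j max_p s_jp.
   Against a feasible coupling q this function is at least
   sum_jp q_jp s_jp >= 0.  If no coupling is feasible, the compact convex image
   of the set of couplings under the constraint slacks misses the nonnegative
   orthant, and a separating functional, evaluated at the coupling which puts
   each p_j on a maximizer of s_jp, is a multiplier with negative value.

   A law which rationalizes b yields a feasible coupling: let q_jp be the
   conditional probability given X = x of the event that Y = y^j and that v_p is
   the largest value not exceeding A.  On this event z_jt <= A iff z_jt <= v_p,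
   while z_jt < v_p only implies z_jt < A, so the two quantile restrictions
   integrate to the two families of linear constraints. *)

Import Order.TTheory GRing.Theory Num.Theory.
Import numFieldNormedType.Exports.

Local Open Scope classical_set_scope.
Local Open Scope ring_scope.

(** * Compactness and separation *)

Lemma continuous_coord (R : realType) (I : eqType) (i : I) :
  continuous (fun q : {ptws I -> R} => q i : R).
Proof. exact: (@proj_continuous I (fun _ => R) i). Qed.

Lemma continuous_sumr (R : realType) (V : topologicalType) (I : Type)
    (r : seq I) (P : pred I) (F : I -> V -> R) :
  (forall i, P i -> continuous (F i)) ->
  continuous (fun q => \sum_(i <- r | P i) F i q).
Proof. by move=> cF; apply: continuous_big => //; exact: add_continuous. Qed.

(** The initial value [g] varies with the point because [seqmax] starts from the head of its list,
    which is itself a function of the point. *)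
Lemma continuous_bigmaxr (R : realType) (V : topologicalType) (I : Type)
    (r : seq I) (g : V -> R) (F : I -> V -> R) :
  continuous g -> (forall i, continuous (F i)) ->
  continuous (fun q => \big[Num.max/g q]_(i <- r) F i q).
Proof.
move=> cg cF; elim: r => [|i r IH].
  by under eq_fun do rewrite big_nil.
under eq_fun do rewrite big_cons.
by move=> q; apply: continuous_max; [exact: cF|exact: IH].
Qed.

Lemma closed_preimage_ge (R : realType) (V : topologicalType) (f : V -> R) c :
  continuous f -> closed [set q | c <= f q].
Proof. by move=> /continuous_closedP cf; exact: (cf _ (@closed_ge _ c)). Qed.

Lemma closed_preimage_le (R : realType) (V : topologicalType) (f : V -> R) c :
  continuous f -> closed [set q | f q <= c].
Proof. by move=> /continuous_closedP cf; exact: (cf _ (@closed_le _ c)). Qed.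

Lemma compact_box (R : realType) (I : eqType) (M : I -> R) :
  compact ([set q | forall i, 0 <= q i <= M i] : set {ptws I -> R}).
Proof.
have := @tychonoff I (fun _ => R) (fun i => `[0, M i]%classic)
  (fun i => @segment_compact R 0 (M i)).
by congr compact; apply/seteqP; split => q /= h i; have := h i; rewrite in_itv.
Qed.

Lemma continuous_compact_min (R : realType) (V : topologicalType) (K : set V)
    (f : V -> R) : K !=set0 -> compact K -> continuous f ->
  exists2 q, K q & forall q', K q' -> f q <= f q'.
Proof.
move=> K0 cK cf.
have [q /set_mem Kq qmin] := @compact_EVT_min _ _ f K K0 cK (continuous_subspaceT cf).
by exists q => // q' Kq'; apply: qmin; exact: mem_set.
Qed.

(* The weights are the negative parts of [c] at the point of [K] whose image
   is nearest to the orthant; the strict inequality is the first-order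
   condition at that point. *)
Lemma orthant_separation (R : realType) (V : topologicalType) (L : finType)
    (K : set V) (c : L -> V -> R) (mix : R -> V -> V -> V) :
  K !=set0 -> compact K -> (forall l, continuous (c l)) ->
  (forall t q q', 0 <= t <= 1 -> K q -> K q' -> K (mix t q q')) ->
  (forall l t q q', c l (mix t q q') = c l q + t * (c l q' - c l q)) ->
  ~ (exists2 q, K q & forall l, 0 <= c l q) ->
  exists2 w : L -> R, forall l, 0 <= w l &
    forall q, K q -> \sum_l w l * c l q < 0.
Proof.
move=> K0 cK cc Kmix cmix infeas.
(* The sum of the squares of these negative parts is the squared distance from the vector [c ^~ q]
   to the nonnegative orthant. *)
pose m l q := Num.max 0 (- c l q).
have cm l : continuous (m l).
  move=> q; apply: (@continuous_max _ _ (fun=> 0) (fun q => - c l q)).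
    exact: cst_continuous.
  by apply: continuousN; exact: cc.
have [q Kq qmin] : exists2 q, K q & forall q', K q' ->
    \sum_l m l q * m l q <= \sum_l m l q' * m l q'.
  apply: continuous_compact_min => //; apply: continuous_sumr => l _ q.
  by apply: continuousM; exact: cm.
have m0 l : 0 <= m l q by rewrite le_max lexx.
exists (m ^~ q) => // q' Kq'.
pose d l := c l q' - c l q.
have mc l : m l q * c l q = - (m l q * m l q).
  by rewrite /m; case: (leP 0 (- c l q)) => _; ring.
(* By [mc], the weighted sum at [q'] is this first-order term minus the squared distance, and that
   distance is positive since otherwise [q] itself would satisfy every constraint. *)
suff dle : \sum_l m l q * d l <= 0.
  have -> : \sum_l m l q * c l q' =
      \sum_l m l q * d l - \sum_l m l q * m l q.
    by rewrite -sumrB; apply: eq_bigr => l _; rewrite -mc /d; ring.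
  suff : 0 < \sum_l m l q * m l q by lra.
  apply: contra_notT infeas; rewrite -leNgt => sum0; exists q => // l.
  have sq0 i : true -> 0 <= m i q * m i q by move=> _; apply: mulr_ge0.
  have : \sum_l m l q * m l q == 0 by rewrite eq_le sum0 sumr_ge0.
  rewrite psumr_eq0 // => /allP /(_ l); rewrite mem_index_enum => /(_ isT).
  rewrite /= mulf_eq0 orbb /m => /eqP E.
  have : - c l q <= Num.max 0 (- c l q) by rewrite le_max lexx orbT.
  by rewrite E; lra.
(* Minimality of [q] is tested against the point at fraction [t] of the way to [q']; there each
   squared negative part is at most the square of [m l q - t * d l]. *)
have step t : 0 <= t <= 1 ->
    2 * t * \sum_l m l q * d l <= t * t * \sum_l d l * d l.
  move=> t01; have := qmin _ (Kmix t q q' t01 Kq Kq').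
  suff : \sum_l m l (mix t q q') * m l (mix t q q') <=
    \sum_l m l q * m l q - 2 * t * \sum_l m l q * d l
      + t * t * \sum_l d l * d l by lra.
  rewrite !mulr_sumr -sumrB -big_split /=; apply: ler_sum => l _.
  rewrite {1 2}/m cmix -/(d l).
  have mge : - c l q <= m l q by rewrite /m le_max lexx orbT.
  case: (leP 0 (- (c l q + t * d l))) => [h|_].
    have h2 : - (c l q + t * d l) <= m l q - t * d l by lra.
    have := ler_pM h h h2 h2; nra.
  by rewrite mul0r; have := sqr_ge0 (m l q - t * d l); nra.
set s := \sum_l _ in step *; set D := \sum_l _ in step.
rewrite leNgt; apply/negP => s0.
have D0 : 0 <= D by apply: sumr_ge0 => l _; rewrite -expr2 sqr_ge0.
have p0 : 0 < s + D + 1 by lra.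
(* A step length short enough that [t * D < s]: dividing [step t] by [t] would give
   [2 * s <= t * D < s], against [0 < s]. *)
have [t [t0 t1 tE]] : exists t, [/\ 0 < t, t <= 1 & t * (s + D + 1) = s].
  exists (s / (s + D + 1)); split; first exact: divr_gt0.
  - by rewrite ler_pdivrMr //; lra.
  - by rewrite divfK ?gt_eqF.
have := step t; rewrite (ltW t0) t1 => /(_ isT).
have ts0 : 0 < t * s by rewrite mulr_gt0.
rewrite -!mulrA (mulrCA 2) ler_pM2l //.
have tDE : t * D = s - t * s - t by rewrite -{1}tE; ring.
by rewrite tDE; lra.
Qed.

(** * Duality of the two linear programs *)

Lemma seqmax_ge (R : realType) (s : seq R) (r : R) : r \in s -> r <= seqmax s.
Proof. by move=> rs; exact: (@le_bigmax_seq _ _ _ s _ r xpredT id). Qed.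

Lemma seqmax_mem (R : realType) (s : seq R) : (0 < size s)%N -> seqmax s \in s.
Proof.
rewrite /seqmax; case: s => //= r0 s _.
(* An arbitrary start [x] is needed: in the recursion the tail keeps the original start instead of
   its own head. *)
have max_mem (x : R) u : \big[Num.max/x]_(r <- u) r \in x :: u.
  elim: u => [|r u IH]; first by rewrite big_nil inE.
  rewrite big_cons; case: leP => _; last by rewrite !inE eqxx orbT.
  by move: IH; rewrite !inE => /orP[->|->]; rewrite ?orbT.
by have := max_mem r0 (r0 :: s); rewrite inE => /orP[/eqP ->|//]; rewrite mem_head.
Qed.

(** The witness [i0] makes [enum I] nonempty, so the head used as initial value is [F i q] for an
    index [i] that does not depend on [q]. *)
Lemma continuous_seqmax (R : realType) (V : topologicalType) (I : finType)
    (i0 : I) (F : I -> V -> R) : (forall i, continuous (F i)) ->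
  continuous (fun q => seqmax [seq F i q | i <- enum I]).
Proof.
move=> cF.
have hd q : head 0 [seq F i q | i <- enum I] = F (head i0 (enum I)) q.
  by case E : (enum I) => [|i s] //; have := mem_enum I i0; rewrite E.
rewrite (_ : (fun q => _) =
    fun q => \big[Num.max/F (head i0 (enum I)) q]_(i <- enum I) F i q).
  exact: continuous_bigmaxr.
by apply/funext => q; rewrite /seqmax hd big_map.
Qed.

Section Duality.
Context {R : realType} {T k J : nat} (tau : R) (x : T.-tuple (vec R k))
  (y : 'I_J -> vec R T) (pr : 'I_J -> R) (b : vec R k).

Local Notation P := (nval x y b).
Local Notation z := (zval x y b).
Local Notation ineq := ('I_P * 'I_T * bool)%type.

Lemma zval_in_values (j : 'I_J) (t : 'I_T) : z j t \in values x y b.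
Proof.
rewrite /values mem_sort mem_undup; apply/allpairsP; exists (j, t) => /=.
by rewrite !mem_enum.
Qed.

Lemma vval_zval (j : 'I_J) (t : 'I_T) : exists p : 'I_P, vval p = z j t.
Proof.
have zv := zval_in_values j t.
have iv : (index (z j t) (values x y b) < P)%N by rewrite index_mem.
by exists (Ordinal iv); rewrite /vval /= nth_index.
Qed.

(** Both families of quantile constraints share one finite index, the boolean selecting the family,
    so that separation applies to a single vector of slacks. *)
Definition slack (l : ineq) (q : 'I_J * 'I_P -> R) : R :=
  let: (p, t, low) := l in
  if low then \sum_(j < J | z j t <= vval p) q (j, p) - tau * \sum_(j < J) q (j, p)
  else tau * \sum_(j < J) q (j, p) - \sum_(j < J | z j t < vval p) q (j, p).

Definition couplings : set {ptws 'I_J * 'I_P -> R} :=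
  [set q | (forall i, 0 <= q i) /\ forall j, \sum_(p < P) q (j, p) = pr j].

Lemma primal_feasibleP :
  primal_feasible tau x y pr b <-> exists2 q, couplings q & forall l, 0 <= slack l q.
Proof.
split=> [[q [q0 qs qlo qhi]]|[q [q0 qs] qsl]].
  exists (fun i => q i.1 i.2); first by split.
  by case=> [[p t] []] /=; rewrite subr_ge0.
exists (fun j p => q (j, p)); split=> // p t.
  by have := qsl (p, t, true); rewrite /= subr_ge0.
by have := qsl (p, t, false); rewrite /= subr_ge0.
Qed.

(** The Lagrangian identity behind both directions of duality: exchanging the sums pairs each
    multiplier with the slack of its own constraint. *)
Lemma sum_score (q : 'I_J * 'I_P -> R) (lm lp : 'I_P -> 'I_T -> R) :
  \sum_(j < J) \sum_(p < P) q (j, p) * score tau lm lp j p =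
  \sum_(p < P) \sum_(t < T)
    (lm p t * slack (p, t, true) q + lp p t * slack (p, t, false) q).
Proof.
rewrite exchange_big; apply: eq_bigr => p _.
under eq_bigr => j _ do rewrite mulr_sumr.
rewrite exchange_big; apply: eq_bigr => t _ /=.
rewrite [\sum_(j < J | z j t <= _) _]big_mkcond.
rewrite [\sum_(j < J | z j t < _) _]big_mkcond.
rewrite !mulr_sumr -!sumrB !mulr_sumr -big_split /=; apply: eq_bigr => j _.
by case: (z j t <= _); case: (z j t < _) => /=; ring.
Qed.

Lemma score_le_seqmax (lm lp : 'I_P -> 'I_T -> R) j p :
  score tau lm lp j p <= seqmax [seq score tau lm lp j p | p <- enum 'I_P].
Proof. by apply: seqmax_ge; apply: map_f; rewrite mem_enum. Qed.

Lemma score_eq_seqmax (p0 : 'I_P) (lm lp : 'I_P -> 'I_T -> R) j :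
  exists p, score tau lm lp j p = seqmax [seq score tau lm lp j p | p <- enum 'I_P].
Proof.
have /mapP[p _ ->] : seqmax [seq score tau lm lp j p | p <- enum 'I_P]
    \in [seq score tau lm lp j p | p <- enum 'I_P].
  by apply: seqmax_mem; rewrite size_map size_enum_ord (leq_ltn_trans _ (ltn_ord p0)).
by exists p.
Qed.

(** For each [j] the masses [q (j, p)] add up to [pr j], so the scores weighted by them stay below
    [pr j] times the maximal score; [sum_score] makes the total a nonnegative combination of
    nonnegative slacks. *)
Lemma weak_duality (lm lp : 'I_P -> 'I_T -> R) :
  (forall p t, 0 <= lm p t /\ 0 <= lp p t) ->
  primal_feasible tau x y pr b -> 0 <= max_score_sum tau x y pr b lm lp.
Proof.
move=> l0 /primal_feasibleP[q [q0 qs] qsl].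
apply: (@le_trans _ _ (\sum_(j < J) \sum_(p < P) q (j, p) * score tau lm lp j p)).
  rewrite sum_score; apply: sumr_ge0 => p _; apply: sumr_ge0 => t _.
  by have [? ?] := l0 p t; rewrite addr_ge0 // mulr_ge0.
apply: ler_sum => j _; rewrite -qs mulr_suml; apply: ler_sum => p _.
by rewrite ler_wpM2l // score_le_seqmax.
Qed.

Lemma compact_couplings : compact couplings.
Proof.
apply: (subclosed_compact _ (compact_box R _ (fun i => pr i.1))); last first.
  move=> q [q0 qs] [j p]; rewrite q0 /= -qs (bigD1 p) //= lerDl.
  by apply: sumr_ge0.
rewrite (_ : couplings = \bigcap_i [set q : {ptws _ -> R} | 0 <= q i] `&`
    (\bigcap_j [set q : {ptws _ -> R} | pr j <= \sum_p q (j, p)] `&`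
     \bigcap_j [set q : {ptws _ -> R} | \sum_p q (j, p) <= pr j])).
  have csum j : continuous (fun q : {ptws ('I_J * 'I_P) -> R} => \sum_p q (j, p)).
    by apply: continuous_sumr => p _; exact: continuous_coord.
  by apply: closedI; [|apply: closedI]; apply: closed_bigI => i _;
    (apply: closed_preimage_ge || apply: closed_preimage_le) => //;
    exact: continuous_coord.
apply/seteqP; split=> [q [q0 qs]|q [q0 [qlo qhi]]] /=.
  by split=> [i _|]; [exact: q0|split=> j _ /=; rewrite qs].
by split=> [i|j]; [exact: q0|apply/eqP; rewrite eq_le qhi // qlo].
Qed.

Lemma continuous_slack l : continuous (slack l : {ptws ('I_J * 'I_P) -> R} -> R).
Proof.
have csum (Q : pred 'I_J) p :
    continuous (fun q : {ptws ('I_J * 'I_P) -> R} => \sum_(j | Q j) q (j, p)).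
  by apply: continuous_sumr => j _; exact: continuous_coord.
have ctau p : continuous
    (fun q : {ptws ('I_J * 'I_P) -> R} => tau * \sum_(j < J) q (j, p)).
  by move=> q; apply: continuousM; [exact: cst_continuous|exact: csum].
case: l => [[p t] []] q.
  exact: (continuousB (csum (fun j => z j t <= vval p) p q) (ctau p q)).
exact: (continuousB (ctau p q) (csum (fun j => z j t < vval p) p q)).
Qed.

Lemma slack_mix (s : R) l (q q' : 'I_J * 'I_P -> R) :
  slack l (fun i => q i + s * (q' i - q i)) =
  slack l q + s * (slack l q' - slack l q).
Proof.
have mixE (Q : pred 'I_J) p : \sum_(j | Q j) (q (j, p) + s * (q' (j, p) - q (j, p)))
    = \sum_(j | Q j) q (j, p)
      + s * (\sum_(j | Q j) q' (j, p) - \sum_(j | Q j) q (j, p)).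
  by rewrite big_split /= -mulr_sumr sumrB.
by case: l => [[p t] []] /=; rewrite !mixE; ring.
Qed.

Lemma couplings_mix (s : R) (q q' : 'I_J * 'I_P -> R) : 0 <= s <= 1 ->
  couplings q -> couplings q' -> couplings (fun i => q i + s * (q' i - q i)).
Proof.
move=> /andP[s0 s1] [q0 qs] [q'0 q's]; split=> [i|j].
  by have := q0 i; have := q'0 i; nra.
by rewrite big_split /= -mulr_sumr sumrB qs q's subrr mulr0 addr0.
Qed.

(** All the mass of [y j] sits on the single value of index [f j]. A constant [f] shows that
    couplings exist; a maximizing [f] turns weighted slacks into maximal scores. *)
Lemma dirac_coupling (f : 'I_J -> 'I_P) : (forall j, 0 < pr j) ->
  couplings (fun i => if i.2 == f i.1 then pr i.1 else 0).
Proof.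
move=> pr0; split=> [i|j /=]; first by case: ifP => // _; apply: ltW.
by rewrite -big_mkcond big_pred1_eq.
Qed.

Lemma strong_duality (p0 : 'I_P) : (forall j, 0 < pr j) ->
  ~ primal_feasible tau x y pr b ->
  exists lm lp, admissible x y b lm lp /\ max_score_sum tau x y pr b lm lp < 0.
Proof.
move=> pr0 infeas.
have K0 : couplings !=set0 by eexists; exact: (dirac_coupling (fun=> p0) pr0).
have [w w0 wneg] : exists2 w : ineq -> R, forall l, 0 <= w l &
    forall q, couplings q -> \sum_l w l * slack l q < 0.
  apply: (orthant_separation R _ _ couplings slack
    (fun s q q' i => q i + s * (q' i - q i))) => //.
  - exact: compact_couplings.
  - exact: continuous_slack.
  - by move=> s q q'; exact: couplings_mix.
  - by move=> l s q q'; exact: slack_mix.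
  - by move/primal_feasibleP; apply: infeas.
have sumE (F : ineq -> R) :
    \sum_l F l = \sum_(p < P) \sum_(t < T) (F (p, t, true) + F (p, t, false)).
  transitivity (\sum_(p < P) \sum_(t < T) \sum_(low : bool) F (p, t, low)).
    by rewrite !pair_bigA; apply: eq_bigr => -[[p t] low].
  by apply: eq_bigr => p _; apply: eq_bigr => t _; rewrite big_bool.
pose W := \sum_l w l.
(* If the total weight vanished, so would every weight, and the separating sum would be zero instead
   of negative. Dividing by [W] then gives multipliers of total mass one without changing the
   sign. *)
have W0 : 0 < W.
  rewrite lt_neqAle sumr_ge0 ?andbT //; apply/eqP => W0.
  have wl0 l : w l = 0.
    have : W == 0 by rewrite -W0.
    rewrite psumr_eq0 // => /allP /(_ l); rewrite mem_index_enum => /(_ isT).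
    by move/eqP.
  have [q Kq] := K0; have := wneg _ Kq; rewrite big1 ?ltxx // => l _.
  by rewrite wl0 mul0r.
pose lm p t := W^-1 * w (p, t, true); pose lp p t := W^-1 * w (p, t, false).
exists lm, lp; split.
  split=> [p t|]; first by rewrite !mulr_ge0 // invr_ge0 ltW.
  under eq_bigr => p _ do under eq_bigr => t _ do rewrite -mulrDr.
  under eq_bigr => p _ do rewrite -mulr_sumr.
  by rewrite -mulr_sumr -sumE mulVf // gt_eqF.
have /choice[f fE] : forall j, exists p, score tau lm lp j p =
    seqmax [seq score tau lm lp j p | p <- enum 'I_P].
  by move=> j; exact: score_eq_seqmax.
have := wneg _ (dirac_coupling f pr0); rewrite sumE.
set q := fun i : 'I_J * 'I_P => _ => wq.
suff -> : max_score_sum tau x y pr b lm lp = W^-1 * \sum_(p < P) \sum_(t < T)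
    (w (p, t, true) * slack (p, t, true) q + w (p, t, false) * slack (p, t, false) q).
  by rewrite pmulr_rlt0 // invr_gt0.
transitivity (\sum_(j < J) \sum_(p < P) q (j, p) * score tau lm lp j p).
  apply: eq_bigr => j _; rewrite -fE (bigD1 (f j)) //= /q eqxx big1 ?addr0 //.
  by move=> p /negPf /= ->; rewrite mul0r.
rewrite sum_score mulr_sumr; apply: eq_bigr => p _.
rewrite mulr_sumr; apply: eq_bigr => t _; rewrite [RHS]mulrDr.
by congr (_ + _); symmetry; exact: mulrA.
Qed.

Lemma admissible_argmin (p0 : 'I_P) :
  exists lm lp, admissible x y b lm lp /\
    forall lm' lp', admissible x y b lm' lp' ->
      max_score_sum tau x y pr b lm lp <= max_score_sum tau x y pr b lm' lp'.
Proof.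
pose lo (w : {ptws ineq -> R}) p t : R := w (p, t, true).
pose hi (w : {ptws ineq -> R}) p t : R := w (p, t, false).
pose K : set {ptws ineq -> R} := [set w | admissible x y b (lo w) (hi w)].
pose g w := max_score_sum tau x y pr b (lo w) (hi w).
have clo p t : continuous (fun w => lo w p t) by exact: continuous_coord.
have chi p t : continuous (fun w => hi w p t) by exact: continuous_coord.
have csum : continuous (fun w => \sum_(p < P) \sum_(t < T) (lo w p t + hi w p t)).
  apply: continuous_sumr => p _; apply: continuous_sumr => t _ w.
  exact: (continuousD (clo p t w) (chi p t w)).
have K0 : K !=set0.
  exists (fun=> 0); split=> [p t|]; first by rewrite /lo /hi lexx.
  rewrite big1 ?ler01 // => p _; rewrite big1 // => t _.
  by rewrite /lo /hi addr0.
have cK : compact K.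
  apply: (subclosed_compact _ (compact_box R _ (fun=> 1))).
    rewrite (_ : K = \bigcap_l [set w : {ptws ineq -> R} | 0 <= w l] `&`
      [set w | \sum_(p < P) \sum_(t < T) (lo w p t + hi w p t) <= 1]).
      apply: closedI; last exact: closed_preimage_le.
      apply: closed_bigI => i _; apply: closed_preimage_ge.
      exact: continuous_coord.
    apply/seteqP; split=> w [w0 w1]; split=> //.
      by case=> [[p t] []] _; have [] := w0 p t.
    by move=> p t; split; exact: w0.
  move=> w [w0 w1] l.
  have ge0 p t : 0 <= lo w p t + hi w p t.
    by have [? ?] := w0 p t; exact: addr_ge0.
  have le1 p t : lo w p t + hi w p t <= 1.
    apply: le_trans w1; rewrite (bigD1 p) //= (bigD1 t) //= -addrA lerDl.
    by rewrite addr_ge0 // ?sumr_ge0 // => p' _; rewrite sumr_ge0.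
  case: l => [[p t] low]; have [lo0 hi0] := w0 p t; have := le1 p t.
  by move: lo0 hi0; rewrite /lo /hi; case: low; lra.
have cg : continuous g.
  have csc j p : continuous (fun w => score tau (lo w) (hi w) j p).
    apply: continuous_sumr => t _ w.
    have cc c : continuous (fun _ : {ptws ineq -> R} => c : R).
      exact: cst_continuous.
    exact: (continuousD (continuousM (clo p t w) (cc _ w))
      (continuousM (chi p t w) (cc _ w))).
  have cm j : continuous (fun w =>
      seqmax [seq score tau (lo w) (hi w) j p | p <- enum 'I_P]).
    exact: (continuous_seqmax _ _ _ p0 _ (csc j)).
  apply: continuous_sumr => j _ w; apply: (continuousM _ (cm j w)).
  exact: cst_continuous.
have [w Kw wmin] := continuous_compact_min _ _ _ _ K0 cK cg.
exists (lo w), (hi w); split=> // lm lp adm.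
(* The two families are packed into one function on [ineq]; its [lo] and [hi] reduce back to [lm]
   and [lp]. *)
exact: (wmin (fun l : ineq => if l.2 then lm l.1.1 l.1.2 else lp l.1.1 l.1.2)).
Qed.

(** This eliminates [d] from the program: for given multipliers the smallest feasible [d j] is the
    maximal score of [j], attained because [p0] shows that there is a value. *)
Lemma max_score_sum_le_dual_obj (p0 : 'I_P) (lm lp : 'I_P -> 'I_T -> R) d :
  (forall j, 0 < pr j) -> dual_feasible tau x y b lm lp d ->
  max_score_sum tau x y pr b lm lp <= dual_obj pr d.
Proof.
move=> pr0 [sd _]; apply: ler_sum => j _; rewrite ler_pM2l //.
by have [p <-] := score_eq_seqmax p0 lm lp j.
Qed.

Lemma dual_optimumP (p0 : 'I_P) : (forall j, 0 < pr j) ->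
  exists lm lp d, [/\ dual_optimal tau x y pr b lm lp d,
    dual_obj pr d = delta tau x y pr b,
    dual_obj pr d = max_score_sum tau x y pr b lm lp &
    forall lm' lp', admissible x y b lm' lp' ->
      dual_obj pr d <= max_score_sum tau x y pr b lm' lp'].
Proof.
move=> pr0; have [lm [lp [adm lmin]]] := admissible_argmin p0.
pose d j := seqmax [seq score tau lm lp j p | p <- enum 'I_P].
have feas : dual_feasible tau x y b lm lp d.
  by split=> // j p; exact: score_le_seqmax.
have opt lm' lp' d' : dual_feasible tau x y b lm' lp' d' ->
    dual_obj pr d <= dual_obj pr d'.
  move=> feas'; apply: le_trans (max_score_sum_le_dual_obj p0 _ _ _ pr0 feas').
  by apply: lmin; case: feas'.
exists lm, lp, d; split=> //.
have lbd : lbound [set r | exists lm lp d,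
    dual_feasible tau x y b lm lp d /\ r = dual_obj pr d] (dual_obj pr d).
  by move=> _ [lm' [lp' [d' [feas' ->]]]]; exact: opt feas'.
(* The set of objective values is nonempty and bounded below, so [inf] is a genuine infimum and not
   a default value. *)
apply/eqP; rewrite eq_le; apply/andP; split.
  by apply: lb_le_inf lbd; exists (dual_obj pr d), lm, lp, d.
by apply: ge_inf; [exists (dual_obj pr d)|exists lm, lp, d].
Qed.

End Duality.

(** * Conditional probabilities *)

Lemma measurable_preimage (d d' : measure_display) (W : measurableType d)
    (S : measurableType d') (f : W -> S) (A : set S) :
  measurable_fun [set: W] f -> measurable A -> measurable (f @^-1` A).
Proof. by move=> mf mA; rewrite -[X in measurable X]setTI; exact: mf. Qed.

Section RealValuedMeasure.
Context {d : measure_display} {W : measurableType d} {R : realType}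
  (P : probability W R).

Lemma fine_probK (A : set W) : measurable A -> (fine (P A))%:E = P A.
Proof. by move=> mA; rewrite fineK // fin_num_measure. Qed.

(** Additivity over disjoint events, then monotonicity inside the union of [H] and [N]. The null set
    [N] lets almost sure inclusions be used as pointwise ones. *)
Lemma sum_prob_le (n : nat) (Q : pred 'I_n) (F : 'I_n -> set W) (H N : set W) :
  (forall i, measurable (F i)) -> measurable H -> measurable N -> P N = 0 ->
  (forall i i' w, F i w -> F i' w -> i = i') ->
  (forall i w, Q i -> F i w -> ~ N w -> H w) ->
  \sum_(i < n | Q i) fine (P (F i)) <= fine (P H).
Proof.
move=> mF mH mN N0 disj FH; rewrite -lee_fin fine_probK // -sumEFin.
under eq_bigr => i _ do rewrite fine_probK //.
rewrite -measure_bigsetU_ord_cond //; last first.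
  by move=> i i' _ _ [w [Fi Fi']]; exact: disj Fi Fi'.
apply: (@le_trans _ _ (P (H `|` N))).
  apply: le_measure; rewrite ?inE.
  - exact: bigsetU_measurable.
  - exact: measurableU.
  - rewrite -bigcup_seq_cond => w -[i /= /andP[_ Qi] Fiw].
    by have [Nw|Nw] := pselect (N w); [right|left; exact: FH Qi Fiw Nw].
apply: le_trans (measureU2 _ mH mN) _.
by rewrite [X in (_ + X)%E](_ : _ = 0%E) ?adde0.
Qed.

Lemma prob_le_sum (I : finType) (Q : pred I) (F : I -> set W) (H N : set W) :
  (forall i, measurable (F i)) -> measurable H -> measurable N -> P N = 0 ->
  (forall w, H w -> ~ N w -> exists2 i, Q i & F i w) ->
  fine (P H) <= \sum_(i | Q i) fine (P (F i)).
Proof.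
move=> mF mH mN N0 HF.
have mU : measurable (\big[setU/set0]_(i | Q i) F i).
  exact: bigsetU_measurable.
rewrite -lee_fin fine_probK //.
apply: (@le_trans _ _ (P (\big[setU/set0]_(i | Q i) F i `|` N))).
  apply: le_measure; rewrite ?inE //; first exact: measurableU.
  rewrite -bigcup_seq_cond => w Hw; have [Nw|Nw] := pselect (N w); first by right.
  have [i Qi Fiw] := HF w Hw Nw; left; exists i => //=.
  by rewrite mem_index_enum.
apply: le_trans (measureU2 _ mU mN) _.
rewrite [X in (_ + X)%E](_ : _ = 0%E) ?adde0 //.
elim: (index_enum I) {HF mU} => [|i r IH]; first by rewrite !big_nil measure0.
rewrite !big_cons; case: ifP => // Qi.
apply: le_trans (measureU2 _ (mF i) _) _; first exact: bigsetU_measurable.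
by rewrite EFinD fine_probK // leeD2l.
Qed.

(** Removing from [D] a null set that contains all failures changes neither integral, and the
    comparison becomes pointwise. *)
Lemma le_integral_ae (D : set W) (f g : W -> \bar R) : measurable D ->
  P.-integrable D f -> P.-integrable D g -> {ae P, forall w, (f w <= g w)%E} ->
  (\int[P]_(w in D) f w <= \int[P]_(w in D) g w)%E.
Proof.
move=> mD fi gi [N [mN N0 fgN]].
have mDN : measurable (D `\` N) by exact: measurableD.
rewrite (negligible_integral mN mD fi N0) (negligible_integral mN mD gi N0).
apply: le_integral => //; [exact: integrableS fi|exact: integrableS gi|].
move=> w; rewrite inE => -[_ Nw]; apply: contrapT => fgw; apply: Nw.
exact: fgN.
Qed.

Context {d' : measure_display} {S : measurableType d'}.

Lemma prob_cst_integral (D : set W) (c : R) : measurable D ->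
  (\int[P]_(w in D) c%:E = c%:E * P D)%E.
Proof. by move=> mD; rewrite (integral_cst P mD). Qed.

(** The event that [V] lies in [G] belongs to the sigma-algebra of [V], so integrating the bound
    over it replaces the conditional restriction by an inequality between plain probabilities. *)
Lemma cond_prob_ge_preimage (V : W -> S) (E : set W) (c : R) (G : set S) :
  measurable_fun [set: W] V -> measurable E -> measurable G ->
  cond_prob_ge P V E c -> c * fine (P (V @^-1` G)) <= fine (P (E `&` V @^-1` G)).
Proof.
move=> mV mE mG [f [_ fi fE] cf].
have mVG : measurable (V @^-1` G) by exact: measurable_preimage.
rewrite -lee_fin EFinM !fine_probK //; last exact: measurableI.
rewrite -fE; last by exists G => //; rewrite setTI.
rewrite -prob_cst_integral //; apply: le_integral_ae => //.
- exact: finite_measure_integrable_cst.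
- exact: integrableS fi.
Qed.

Lemma cond_prob_le_preimage (V : W -> S) (E : set W) (c : R) (G : set S) :
  measurable_fun [set: W] V -> measurable E -> measurable G ->
  cond_prob_le P V E c -> fine (P (E `&` V @^-1` G)) <= c * fine (P (V @^-1` G)).
Proof.
move=> mV mE mG [f [_ fi fE] cf].
have mVG : measurable (V @^-1` G) by exact: measurable_preimage.
rewrite -lee_fin EFinM !fine_probK //; last exact: measurableI.
rewrite -fE; last by exists G => //; rewrite setTI.
rewrite -prob_cst_integral //; apply: le_integral_ae => //.
- exact: integrableS fi.
- exact: finite_measure_integrable_cst.
Qed.

End RealValuedMeasure.

(** The general space [S] allows two uses in succession: for vectors of reals, then for paths, which
    are tuples of vectors. *)
Lemma measurable_tuple1 (d : measure_display) (S : measurableType d) (n : nat)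
    (a : n.-tuple S) :
  (forall s : S, measurable [set s]) -> measurable [set a].
Proof.
move=> m1; rewrite (_ : [set a] =
    \bigcap_(i in [set: 'I_n]) ((@tnth n S)^~ i @^-1` [set tnth a i])).
  apply: fin_bigcap_measurable => // i _.
  by apply: measurable_preimage => //; exact: measurable_tnth.
apply/seteqP; split=> [_ -> //|u ua]; apply: eq_from_tnth => i; exact: ua.
Qed.

(** * From a rationalizing law to a feasible coupling *)

Section Cells.
Context {R : realType} {T k J : nat} (x : T.-tuple (vec R k))
  (y : 'I_J -> vec R T) (b : vec R k).

Local Notation P := (nval x y b).
Local Notation z := (zval x y b).

(* The effects [a] for which [vval p] is the largest value not exceeding [a]. *)
Definition cell (p : 'I_P) : set (measurableTypeR R) :=
  [set a | vval p <= (a : R) /\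
    forall p' : 'I_P, vval p < vval p' -> (a : R) < vval p'].

Lemma vval_inj : injective (@vval R T k J x y b).
Proof.
move=> p p' /eqP; rewrite /vval nth_uniq //; last by rewrite sort_uniq undup_uniq.
by move=> /eqP /val_inj.
Qed.

Lemma cell_inj (a : R) p p' : cell p a -> cell p' a -> p = p'.
Proof.
move=> [pa ap] [p'a ap']; apply: vval_inj; apply/eqP.
rewrite eq_le !leNgt; apply/andP; split; apply/negP.
  by move=> /ap'; rewrite ltNge pa.
by move=> /ap; rewrite ltNge p'a.
Qed.

(** The cells miss only the effects below every value; any other effect lies in the cell of the
    largest value not exceeding it. *)
Lemma cell_cover (a : R) (p : 'I_P) : vval p <= a -> exists p', cell p' a.
Proof.
move=> pa.
case: (@arg_maxP _ _ _ p (fun p' => vval p' <= a) (@vval R T k J x y b) pa).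
move=> p' p'a p'max; exists p'; split=> // q p'q; rewrite ltNge; apply/negP => qa.
by have : vval q <= vval p' := p'max q qa; rewrite leNgt p'q.
Qed.

(** Every [z j t] is one of the values, and no value lies strictly above [vval p] and at most at
    [a]. *)
Lemma cell_le (a : R) p j t : cell p a -> (z j t <= a) = (z j t <= vval p).
Proof.
move=> [pa ap]; have [q <-] := vval_zval x y b j t.
apply/idP/idP => [qa|]; last by move/le_trans; apply.
by rewrite leNgt; apply/negP => /ap; rewrite ltNge qa.
Qed.

Lemma measurable_cell p : measurable (cell p).
Proof.
rewrite (_ : cell p = `[vval p, +oo[%classic `&`
    \bigcap_(p' in [set p' : 'I_P | vval p < vval p']) `]-oo, vval p'[%classic).
  apply: measurableI; first exact: measurable_itv.
  by apply: fin_bigcap_measurable => // p' _; exact: measurable_itv.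
by apply/seteqP; split=> a /=; rewrite in_itv /= andbT => -[pa ap]; split=> // p' pp';
  have := ap p' pp'; rewrite /= in_itv.
Qed.

End Cells.

Lemma identified_primal_feasible (R : realType) (T k : nat) (tau : R)
    (B : set (vec R k)) (Pobs : probability (obs R T k) R)
    (J : nat) (x : T.-tuple (vec R k)) (y : 'I_J -> vec R T)
    (pr : 'I_J -> R) (b : vec R k) :
  (0 < T)%N -> 0 < tau -> (0 < Pobs [set w | w.2 = x])%E ->
  (forall j, pr_given Pobs [set w | w.1 = y j] [set w | w.2 = x] = pr j) ->
  injective y -> \sum_(j < J) pr j = 1 ->
  identified_set tau B Pobs b -> primal_feasible tau x y pr b.
Proof.
move=> T0 tau0 Px0 prE yinj pr1 [_ [Ps [marg Yae Uge Ule]]].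
have mvec n : forall v : vec R n, measurable [set v].
  by move=> v; apply: measurable_tuple1 => r; exact: measurable_set1.
have mx : measurable [set x] by apply: measurable_tuple1; exact: mvec.
have mXo : measurable [set w : obs R T k | w.2 = x].
  exact: measurable_preimage measurable_snd mx.
have mYo j : measurable [set w : obs R T k | w.1 = y j].
  exact: measurable_preimage measurable_fst (mvec _ (y j)).
have mA : measurable_fun [set: latent R T k] Aof.
  exact: (measurableT_comp measurable_fst measurable_snd).
have mY : measurable_fun [set: latent R T k] Yof.
  exact: (measurableT_comp measurable_fst measurable_fst).
have mX : measurable_fun [set: latent R T k] Xof.
  exact: (measurableT_comp measurable_snd measurable_fst).
have mU t : measurable_fun [set: latent R T k] (fun w => tnth (Uof w) t).
  apply: (measurableT_comp (measurable_tnth _)).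
  exact: (measurableT_comp measurable_snd measurable_snd).
have mXA : measurable_fun [set: latent R T k] XAof.
  exact: (measurable_fun_pair mX mA).
have mUle t : measurable [set w : latent R T k | (tnth (Uof w) t : R) <= 0].
  rewrite (_ : mkset _ = (fun w => tnth (Uof w) t) @^-1` `]-oo, 0]%classic).
    by apply: measurable_preimage => //; exact: measurable_itv.
  by apply/seteqP; split=> w /=; rewrite in_itv.
have mUlt t : measurable [set w : latent R T k | (tnth (Uof w) t : R) < 0].
  rewrite (_ : mkset _ = (fun w => tnth (Uof w) t) @^-1` `]-oo, 0[%classic).
    by apply: measurable_preimage => //; exact: measurable_itv.
  by apply/seteqP; split=> w /=; rewrite in_itv.
pose m A := fine (Ps A).
pose F := [set w : latent R T k | Xof w = x].
pose E j := [set w : latent R T k | Yof w = y j].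
have mF : measurable F by exact: measurable_preimage mX mx.
have mE j : measurable (E j).
  exact: measurable_preimage mY (mvec _ (y j)).
have F0 : 0 < m F.
  by rewrite -lte_fin fine_probK // (marg _ mXo).
have EF j : m (E j `&` F) = pr j * m F.
  rewrite /m (marg _ mXo) (marg _ (measurableI _ _ (mYo j) mXo)).
  rewrite -prE /pr_given divfK //.
  by rewrite -(marg _ mXo) gt_eqF.
have Edisj j j' w : E j w -> E j' w -> j = j'.
  by rewrite /E /= => -> /yinj.
(* The finitely many almost sure equations are merged, so that one null set [N1] serves all
   periods. *)
have [N1 [mN1 N10 YN1]] : {ae Ps, forall w, forall t, (tnth (Yof w) t : R) =
    dotp (tnth (Xof w) t) b + (Aof w : R) + (tnth (Uof w) t : R)}.
  by apply: filter_forall => t; exact: Yae.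
(* Given the path and the outcome, the sign of the error records how [zval x y b j t] compares with
   the effect. *)
have UE w j t : ~ N1 w -> F w -> E j w ->
    (tnth (Uof w) t : R) = zval x y b j t - (Aof w : R).
  move=> N1w Fw Ew; have /(_ t) : forall t, (tnth (Yof w) t : R) =
    dotp (tnth (Xof w) t) b + (Aof w : R) + (tnth (Uof w) t : R).
    by apply: contrapT => nY; apply: N1w; exact: YN1.
  by rewrite Fw Ew /zval => ->; ring.
(* The part of [F] where the outcome is none of the [y j]; it is null because the [pr j] sum to
   one. *)
pose D := F `\` \big[setU/set0]_j E j.
have mEU : measurable (\big[setU/set0]_j E j) by exact: bigsetU_measurable.
have mD : measurable D by exact: measurableD.
have EUP w : (\big[setU/set0]_j E j) w -> exists j, E j w.
  by rewrite -bigcup_seq => -[j _ Ew]; exists j.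
have D0 : Ps D = 0%E.
  have mFE : measurable (F `&` \big[setU/set0]_j E j) by exact: measurableI.
  have FE : m F <= m (F `&` \big[setU/set0]_j E j).
    rewrite -[leLHS]mul1r -pr1 mulr_suml.
    rewrite (eq_bigr _ (fun j _ => esym (EF j))).
    apply: (sum_prob_le Ps _ _ _ _ set0) => //.
    - by move=> j; exact: measurableI.
    - by move=> j j' w [Ew _] [Ew' _]; exact: Edisj Ew Ew'.
    - move=> j w _ [Ew Fw] _; split=> //.
      by rewrite -bigcup_seq; exists j => //=; rewrite mem_index_enum.
  have DI : m F = m D + m (F `&` \big[setU/set0]_j E j).
    apply: EFin_inj; rewrite EFinD !fine_probK //; exact: measureDI.
  have : m D <= 0 by rewrite -(lerD2r (m (F `&` \big[setU/set0]_j E j))) -DI add0r.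
  rewrite -lee_fin fine_probK // => mD0.
  by apply/eqP; rewrite eq_le mD0 measure_ge0.
(* On [L] the effect lies below every value, so almost surely all errors are positive; the lower
   quantile restriction with [0 < tau] forces [L] to be null. *)
pose L := XAof @^-1` ([set x] `*` [set a : measurableTypeR R |
  forall p : 'I_(nval x y b), (a : R) < vval p]) : set (latent R T k).
have mLA : measurable [set a : measurableTypeR R |
    forall p : 'I_(nval x y b), (a : R) < vval p].
  rewrite (_ : mkset _ =
      \bigcap_(p in [set: 'I_(nval x y b)]) `]-oo, vval p[%classic).
    by apply: fin_bigcap_measurable => // p' _; exact: measurable_itv.
  by apply/seteqP; split=> a /= ap p; have := ap p; rewrite /= in_itv //=; apply.
have mxLA := measurableX mx mLA.
have mL : measurable L by exact: measurable_preimage.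
have cover w : F w -> ~ D w -> exists j, E j w.
  by move=> Fw Dw; apply: EUP; apply: contrapT => Ew; apply: Dw.
have mN1D : measurable (N1 `|` D) by exact: measurableU.
have N1D0 : Ps (N1 `|` D) = 0%E.
  apply/eqP; rewrite eq_le measure_ge0 andbT.
  have : (Ps (N1 `|` D) <= Ps N1 + Ps D)%E by exact: measureU2.
  by rewrite N10 D0 adde0.
have L0 : Ps L = 0%E.
  have t0 : 'I_T := Ordinal T0.
  have := cond_prob_ge_preimage Ps _ _ _ _ mXA (mUle t0) mxLA (Uge t0).
  set H := _ `&` _ => tauL.
  (* The empty sum expresses that [H] lies entirely inside the null set [N1] joined with [D]. *)
  have H0 : fine (Ps H) <= \sum_(i < 0) fine (Ps set0).
    apply: (prob_le_sum Ps _ _ (fun=> set0) _ (N1 `|` D)) => //.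
      exact: measurableI.
    move=> w [Uw [Fw LA]] /not_orP[N1w Dw]; have [j Ew] := cover w Fw Dw.
    have [p pz] := vval_zval x y b j t0.
    move: Uw; rewrite /= (UE w j t0 N1w Fw Ew) subr_le0 -pz leNgt.
    by rewrite (LA p).
  rewrite big_ord0 in H0.
  have : fine (Ps L) <= 0.
    by rewrite -(pmulr_rle0 _ tau0); exact: le_trans tauL H0.
  rewrite -lee_fin fine_probK // => L0.
  by apply/eqP; rewrite eq_le L0 measure_ge0.
pose G p := XAof @^-1` ([set x] `*` cell x y b p) : set (latent R T k).
have mG p : measurable (G p).
  apply: measurable_preimage => //.
  by apply: measurableX => //; exact: measurable_cell.
have mEG j p : measurable (E j `&` G p) by exact: measurableI.
have GF p w : G p w -> F w by case.
exists (fun j p => m (E j `&` G p) / m F); split.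
- by move=> j p; rewrite divr_ge0 // fine_ge0.
- move=> j; rewrite -mulr_suml.
  (* The cells partition the event [E j] within [F], up to the null set [L]. *)
  suff -> : \sum_p m (E j `&` G p) = m (E j `&` F) by rewrite EF mulfK // gt_eqF.
  apply/eqP; rewrite eq_le; apply/andP; split.
    apply: (sum_prob_le Ps _ _ _ _ set0) => //; first exact: measurableI.
      by move=> p p' w [_ [_ c]] [_ [_ c']]; exact: cell_inj c c'.
    by move=> p w _ [Ew /GF Fw] _.
  apply: (prob_le_sum Ps _ _ _ _ L) => //; first exact: measurableI.
  move=> w [Ew Fw] Lw.
  have [p pA] : exists p : 'I_(nval x y b), vval p <= (Aof w : R).
    apply: contrapT => np; apply: Lw; split=> // p.
    by rewrite ltNge; apply/negP => pA; apply: np; exists p.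
  by have [p' cp'] := cell_cover _ _ _ _ _ pA; exists p'.
- move=> p t; rewrite -!mulr_suml mulrA ler_pM2r ?invr_gt0 //.
  (* The disjoint [E j] carry at most the mass of [G p]; the quantile restriction bounds
     [tau * m (G p)] by the mass of nonpositive errors on [G p], which [cell_le] places on the [j]
     with [z j t <= vval p]. *)
  apply: (@le_trans _ _ (tau * m (G p))).
    rewrite ler_pM2l //; apply: (sum_prob_le Ps _ _ _ _ set0) => //.
      by move=> j j' w [Ew _] [Ew' _]; exact: Edisj Ew Ew'.
    by move=> j w _ [].
  apply: le_trans (cond_prob_ge_preimage Ps _ _ _ _ mXA (mUle t) _ (Uge t)) _.
    by apply: measurableX => //; exact: measurable_cell.
  apply: (prob_le_sum Ps _ _ _ _ (N1 `|` D)) => //;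
    first exact: measurableI (mUle t) (mG p).
  move=> w [Uw Gw] /not_orP[N1w Dw]; have [j Ew] := cover w (GF _ _ Gw) Dw.
  exists j => //; rewrite -(cell_le _ _ _ _ _ j t (proj2 Gw)) -subr_le0.
  by rewrite -(UE w j t N1w (GF _ _ Gw) Ew).
- move=> p t; rewrite -!mulr_suml mulrA ler_pM2r ?invr_gt0 //.
  (* The chain now runs the other way: the [E j] must cover [G p] up to [D], and [z j t < vval p]
     gives a negative error because the effect is at least [vval p] on the cell. *)
  apply: (@le_trans _ _ (tau * m (G p))); last first.
    rewrite ler_pM2l //; apply: (prob_le_sum Ps _ _ _ _ D) => //.
    move=> w Gw Dw; have [j Ew] := cover w (GF _ _ Gw) Dw.
    by exists j.
  apply: le_trans (cond_prob_le_preimage Ps _ _ _ _ mXA (mUlt t) _ (Ule t)); last first.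
    by apply: measurableX => //; exact: measurable_cell.
  apply: (sum_prob_le Ps _ _ _ _ N1) => //; first exact: measurableI (mUlt t) (mG p).
    by move=> j j' w [Ew _] [Ew' _]; exact: Edisj Ew Ew'.
  move=> j w zv [Ew Gw] N1w; split=> //=.
  rewrite (UE w j t N1w (GF _ _ Gw) Ew) subr_lt0; apply: lt_le_trans zv _.
  by have [_ []] := Gw.
Qed.

(** * Sign of the optimal value and exclusion of the parameter *)

Theorem proposition6p4 (R : realType) (T k : nat) (tau : R)
    (B : set (vec R k)) (Pobs : probability (obs R T k) R)
    (J : nat) (x : T.-tuple (vec R k)) (y : 'I_J -> vec R T)
    (pr : 'I_J -> R) (b : vec R k)
    (hT : (0 < T)%N) (hk : (0 < k)%N) (htau : 0 < tau < 1)
    (hsupp : X_finite_support Pobs)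
    (hx : (0 < Pobs [set w | w.2 = x])%E)
    (hpr : forall j : 'I_J,
       pr_given Pobs [set w | w.1 = y j] [set w | w.2 = x] = pr j)
    (hpr0 : forall j : 'I_J, 0 < pr j)
    (hy : injective y)
    (hpr1 : \sum_(j < J) pr j = 1)
    (hb : B b) :
  let dlt := delta tau x y pr b in
  [/\ exists lm lp d,
        dual_optimal tau x y pr b lm lp d /\ dual_obj pr d = dlt,
      dlt <= 0,
      dlt = 0 <-> primal_feasible tau x y pr b,
      dlt < 0 <-> ~ primal_feasible tau x y pr b &
      dlt < 0 ->
        [/\ forall lm lp d, dual_optimal tau x y pr b lm lp d ->
              max_score_sum tau x y pr b lm lp < 0,
            forall lm lp, admissible x y b lm lp ->
              max_score_sum tau x y pr b lm lp < 0 ->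
              ~ identified_set tau B Pobs b &
            ~ identified_set tau B Pobs b]].
Proof.
have tau0 : 0 < tau by case/andP: htau.
(* Some [y j] exists since the [pr j] sum to one, and some period exists by [hT]; hence there is a
   value, and no maximum falls back on the default of an empty list. *)
have [p0] : inhabited 'I_(nval x y b).
  have j0 : 'I_J.
    case: J pr hpr1 {hpr hpr0 hy y} => [pr|n _ _]; last exact: ord0.
    by rewrite big_ord0 => /eqP; rewrite eq_sym oner_eq0.
  by have [p _] := vval_zval x y b j0 (Ordinal hT).
have [lm [lp [d [opt objE scoreE dmin]]]] := dual_optimumP tau x y pr b p0 hpr0.
have dle0 : delta tau x y pr b <= 0.
  rewrite -objE; case: opt => _ /(_ (fun _ _ => 0) (fun _ _ => 0) (fun=> 0)).
  rewrite [X in _ <= X]big1; last by move=> j _; rewrite mulr0.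
  apply; split=> [j p|].
    by rewrite /score big1 // => t _; rewrite !mul0r addr0.
  split=> [p t|]; first by rewrite lexx.
  by rewrite big1 ?ler01 // => p _; rewrite big1 // => t _; rewrite addr0.
have feas_ge0 lm' lp' : admissible x y b lm' lp' ->
    primal_feasible tau x y pr b -> 0 <= max_score_sum tau x y pr b lm' lp'.
  by case=> l0 _; exact: weak_duality.
(* Together with [dle0] this equivalence yields both sign characterizations. *)
have feasE : primal_feasible tau x y pr b <-> 0 <= delta tau x y pr b.
  split=> [feas|d0].
    by rewrite -objE scoreE; apply: feas_ge0 => //; case: opt => -[].
  apply: contrapT => infeas.
  have [lm' [lp' [adm neg]]] := strong_duality tau x y pr b p0 hpr0 infeas.
  have := le_lt_trans (dmin lm' lp' adm) neg.
  by rewrite objE ltNge d0.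
have ident_feas : identified_set tau B Pobs b -> primal_feasible tau x y pr b.
  exact: identified_primal_feasible.
split=> //.
- by exists lm, lp, d.
- rewrite feasE; split=> [->|d0]; first exact: lexx.
  by apply/eqP; rewrite eq_le dle0 d0.
- rewrite feasE ltNge; split=> [/negP|/negP] //.
- move=> dlt0; split.
  + move=> lm' lp' d' [feas' dmin'].
    (* Any optimal solution qualifies, not just the constructed one: its maximal scores are bounded
       by its own [d'], whose objective is at most the optimal value. *)
    apply: le_lt_trans dlt0; rewrite -objE.
    apply: le_trans (max_score_sum_le_dual_obj _ _ _ _ _ p0 _ _ _ hpr0 feas') _.
    by apply: (dmin' lm lp d); case: opt.
  + move=> lm' lp' adm neg /ident_feas /(feas_ge0 _ _ adm).
    by rewrite leNgt neg.
  + by move=> /ident_feas /feasE; rewrite leNgt dlt0.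
Qed.
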